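(* Let $\mathbb{A}=[A_{i,j}]_{1\le i\le p,\,1\le j\le q}$ be a complex matrix partitioned in blocks of arbitrary size (so $A_{i,j}$ is an $n_i\times m_j$ matrix for some positive integers $n_1,\dots,n_p$ and $m_1,\dots,m_q$), and let $f:[0,\infty)\to\mathbb{R}$ be a continuous function with $f(0)\ge 0$. If the function $t\mapsto f(\sqrt{t})$ is concave on $[0,\infty)$, then $$ \mathrm{Tr}\,f(|\mathbb{A}|)\le\sum_{i,j}\mathrm{Tr}\,f(|A_{i,j}|). $$
   Context: For a (possibly rectangular) complex matrix $X$, $|X|=(X^*X)^{1/2}$, a square positive semi-definite matrix whose size is the number of columns of $X$. For a positive semi-definite $P$, $f(P)$ is defined by the functional calculus. $\mathrm{Tr}$ is the usual trace. *)

(* Defs.v *)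
From HB Require Import structures.
From mathcomp Require Import all_boot all_order all_algebra complex.
From mathcomp Require Import all_classical all_reals all_analysis.

Set Implicit Arguments.
Unset Strict Implicit.
Unset Printing Implicit Defensive.

Import Order.TTheory GRing.Theory Num.Theory.
Import numFieldNormedType.Exports.

Local Open Scope ring_scope.
Local Open Scope complex_scope.
Local Open Scope convex_scope.
Local Open Scope classical_set_scope.
Local Open Scope sesquilinear_scope.

(* The mirror image of [convex_function]; MathComp-Analysis has no concave
   counterpart. *)
Definition concave_function (R : numFieldType) (E : lmodType R)
    (E' := convex_lmodType E) (D : set E') (f : E' -> R^o) :=
  forall t : {i01 R},
    {in D &, forall x y : E', (f x <| t |> f y <= f (x <| t |> y))%R}.

(* The lift to R[i] of f : R -> R; it is only ever applied to eigenvalues of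
   Hermitian matrices, which are real, so that taking [Re] loses nothing. *)
Definition lift_real (R : realType) (f : R -> R) (z : R[i]) : R[i] :=
  (f (complex.Re z))%:C.

(* Functional calculus f(P), meaningful when P is Hermitian. The result does not
   depend on the diagonalization chosen by [spectralmx], see [mxfunE]. *)
Definition mxfun (R : realType) (f : R -> R) (n : nat) (P : 'M[R[i]]_n) :
    'M[R[i]]_n :=
  invmx (spectralmx P) *m diag_mx (map_mx (lift_real f) (spectral_diag P))
    *m spectralmx P.

Definition mxabs (R : realType) (n m : nat) (X : 'M[R[i]]_(n, m)) :
    'M[R[i]]_m :=
  mxfun Num.sqrt (X^t* *m X).

Lemma mxfunE (R : realType) (f : R -> R) (n : nat) (U : 'M[R[i]]_n)
    (d : 'rV[R[i]]_n) :
  U \is unitarymx ->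
  mxfun f (U^t* *m diag_mx d *m U) = U^t* *m diag_mx (map_mx (lift_real f) d) *m U.
Proof.
move=> Uu; set P := _ *m U.
have Uin := unitarymx_unit Uu.
have PE : P = invmx U *m diag_mx d *m U by rewrite invmx_unitary.
have Pn : P \is normalmx.
  by apply/orthomx_spectral_subproof; exists (U, d).
move/orthomx_spectralP: Pn; rewrite -(invmx_unitary Uu) /mxfun.
set V := spectralmx P; set e := spectral_diag P => PV.
have Vin : V \in unitmx := spectral_unit P.
set W := V *m invmx U.
have key : diag_mx e *m W = W *m diag_mx d.
  apply: (can_inj (mulKmx (_ : invmx V \in unitmx))); first by rewrite unitmx_inv.
  apply: (can_inj (mulmxK Uin)).
  by rewrite !mulmxA mulmxKV // -PV mulVmx // mul1mx -PE.
have keyf : diag_mx (map_mx (lift_real f) e) *m W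
    = W *m diag_mx (map_mx (lift_real f) d).
  move: W key => W key; apply/matrixP => i j; move/matrixP/(_ i j): key.
  rewrite !mul_diag_mx !mul_mx_diag !mxE.
  have [->|W0] := eqVneq (W i j) 0; first by rewrite !mulr0 !mul0r.
  by rewrite mulrC => /(mulfI W0) ->; rewrite mulrC.
apply: (can_inj (mulKmx Vin)); apply: (can_inj (mulmxK (_ : invmx U \in unitmx))).
  by rewrite unitmx_inv.
by rewrite !mulmxA mulmxV // mul1mx -[_ *m V *m _]mulmxA -/W keyf mulmxK.
Qed.

(* Main.v *)
(* Put g(t) = f(sqrt t), so that Tr f(|X|) is the sum of g over the eigenvalues
   of X^*X. If t_l = \sum_k c_lk s_k with c >= 0, row sums at most 1 and column
   sums equal to 1 on the support of s, Jensen's inequality with the missing mass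
   of each row put at 0 gives \sum_k g(s_k) <= \sum_l g(t_l), because g(0) >= 0,
   provided there are at least as many indices l as k.
   With s the spectrum of X^*X and V an orthonormal eigenbasis (as rows), such a
   c exists in two cases; W_j are eigenbases and t the spectra of the blocks:
   - X a row of blocks X_j: c = |W_j V_j^*|^2 entrywise, V_j the columns of V
     belonging to X_j;
   - X a column of blocks X_i: c_(i,l),k = t_il |Y_i(l,k)|^2 / s_k, with
     Y_i = W_i V^*.
   A block matrix is a row of columns of blocks. *)

Require Import Defs.
From HB Require Import structures.
From mathcomp Require Import all_boot all_order all_algebra complex.
From mathcomp Require Import all_classical all_reals all_analysis.

Set Implicit Arguments.
Unset Strict Implicit.
Unset Printing Implicit Defensive.

Import Order.TTheory GRing.Theory Num.Theory.
Import numFieldNormedType.Exports.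

Local Open Scope classical_set_scope.
Local Open Scope complex_scope.
Local Open Scope ring_scope.
Local Open Scope sesquilinear_scope.

(** * Jensen's inequality with substochastic weights *)

(** Induction on [r]: two-point concavity splits off the first point, and the remaining weights are
    renormalized by [1 - c x]; the missing mass stays at 0 throughout. *)
Lemma concave_jensen (R : realType) (g : R -> R)
    (g_concave : concave_function (`[0, +oo[%classic : set R^o) g)
    (I : Type) (r : seq I) (c s : I -> R) :
  (forall i, 0 <= c i) -> (forall i, 0 <= s i) -> \sum_(i <- r) c i <= 1 ->
  \sum_(i <- r) c i * g (s i) + (1 - \sum_(i <- r) c i) * g 0
    <= g (\sum_(i <- r) c i * s i).
Proof.
have conc t x y : 0 <= t -> t <= 1 -> 0 <= x -> 0 <= y ->
    t * g x + (1 - t) * g y <= g (t * x + (1 - t) * y).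
  move=> t0 t1 x0 y0.
  have t01 : Itv.spec (@Itv.num_sem R) (Itv.Real `[0, 1]%Z) t.
    by rewrite /Itv.spec/= /Itv.num_sem/= in_itv/= t0 t1 ger0_real.
  have := g_concave (Itv.mk t01) x y.
  by rewrite !inE/= !in_itv/= !andbT => /(_ x0 y0).
move=> c0 s0; elim: r c c0 => [|x r IH] c c0.
  by rewrite !big_nil add0r subr0 mul1r.
rewrite !big_cons => cle1.
have sum0 : 0 <= \sum_(i <- r) c i by apply: sumr_ge0.
(* Renormalizing divides by [1 - c x], so weight 1 is treated apart: the weights along [r] are then
   nonnegative with sum 0, hence vanish. *)
have [cx1|cx1] := eqVneq (c x) 1.
  have {}sum0 : \sum_(i <- r) c i = 0.
    by apply/eqP; rewrite eq_le sum0 andbT; move: cle1; rewrite cx1 gerDl.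
  have E F : \sum_(i <- r) c i * F i = 0.
    elim: {IH cle1} r sum0 => [|y r IH]; first by rewrite !big_nil.
    rewrite !big_cons => /eqP; rewrite paddr_eq0 ?sumr_ge0// => /andP[/eqP-> /eqP].
    by rewrite mul0r add0r.
  by rewrite !E sum0 cx1 !addr0 subrr mul0r addr0 !mul1r.
have cx_lt1 : 0 < 1 - c x.
  by rewrite subr_gt0 lt_neqAle cx1 (le_trans _ cle1)// lerDl.
pose c' i := c i / (1 - c x).
have c'E F : \sum_(i <- r) c' i * F i = (\sum_(i <- r) c i * F i) / (1 - c x).
  by rewrite mulr_suml; apply: eq_bigr => i _; rewrite /c' mulrAC.
have c'S : \sum_(i <- r) c' i = (\sum_(i <- r) c i) / (1 - c x).
  by rewrite mulr_suml.
have c'0 i : 0 <= c' i by rewrite divr_ge0// ltW.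
have := IH c' c'0; rewrite c'S ler_pdivrMr// mul1r lerBrDl => /(_ cle1).
rewrite !c'E => {}IH.
have y0 : 0 <= (\sum_(i <- r) c i * s i) / (1 - c x).
  by rewrite divr_ge0// ?(ltW cx_lt1)// sumr_ge0// => i _; rewrite mulr_ge0.
have := conc (c x) (s x) _ (c0 x) _ (s0 x) y0.
rewrite -subr_ge0 (ltW cx_lt1) [(1 - c x) * (_ / _)]mulrC mulfVK ?gt_eqF//.
move=> /(_ isT).
apply: le_trans; rewrite -addrA lerD2l.
move: IH; rewrite -(ler_pM2l cx_lt1); apply: le_trans.
rewrite mulrDr mulrCA divff ?gt_eqF// mulr1 lerD2l mulrA mulrBr mulr1 mulrCA.
by rewrite divff ?gt_eqF// mulr1 opprD addrA.
Qed.

(** After Jensen for each [l], the coefficient of [g (s k)] is a column sum. It can differ from 1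
    only where [s k = 0], so every discrepancy is a multiple of [g 0]; together with the missing row
    masses they total [(#|L| - #|K|) * g 0]. *)
Lemma substochastic_concave_le (R : realType) (g : R -> R)
    (g_concave : concave_function (`[0, +oo[%classic : set R^o) g)
    (g0_ge0 : 0 <= g 0) (K L : finType) (s : K -> R) (t : L -> R)
    (c : L -> K -> R) :
  (#|K| <= #|L|)%N -> (forall k, 0 <= s k) -> (forall l k, 0 <= c l k) ->
  (forall l, \sum_k c l k <= 1) ->
  (forall k, s k != 0 -> \sum_l c l k = 1) ->
  (forall l, t l = \sum_k c l k * s k) ->
  \sum_k g (s k) <= \sum_l g (t l).
Proof.
move=> leKL s0 c0 row col tE.
apply: (@le_trans _ _ (\sum_l
    (\sum_k c l k * g (s k) + (1 - \sum_k c l k) * g 0))); last first.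
  by apply: ler_sum => l _; rewrite tE (concave_jensen g_concave).
rewrite big_split/= -mulr_suml exchange_big/=.
rewrite -subr_ge0 addrAC -sumrB.
have -> : \sum_k (\sum_l c l k * g (s k) - g (s k)) =
    (\sum_k (\sum_l c l k - 1)) * g 0.
  rewrite mulr_suml; apply: eq_bigr => k _; rewrite -mulr_suml mulrBl mul1r.
  by have [->//|/col->] := eqVneq (s k) 0; rewrite !mul1r !subrr.
rewrite -mulrDl !sumrB !sumr_const mulr_ge0// exchange_big/=.
by rewrite addrC addrA subrK subr_ge0 ler_nat.
Qed.

(** * Spectral data of Gram matrices *)

Section GramSpectrum.
Variable R : realType.
Local Notation C := R[i].

(* A squared modulus valued in [R], where [`|z| ^+ 2] is valued in [R[i]]. *)
Definition sqmod (z : C) : R := complex.Re z ^+ 2 + complex.Im z ^+ 2.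

Lemma sqmodE (z : C) : (sqmod z)%:C = z * Num.conj z.
Proof. by rewrite add_Re2_Im2 normCK. Qed.

Lemma sqmod_ge0 (z : C) : 0 <= sqmod z.
Proof. by rewrite addr_ge0// sqr_ge0. Qed.

Lemma sqmodJ (z : C) : sqmod (Num.conj z) = sqmod z.
Proof. by apply: complexI; rewrite !sqmodE conjCK mulrC. Qed.

Definition rdiag_mx n (d : 'I_n -> R) : 'M[C]_n := diag_mx (\row_k (d k)%:C).

Lemma rdiag_mx1 n : rdiag_mx (fun=> 1) = 1%:M :> 'M[C]_n.
Proof. by apply/matrixP => i j; rewrite !mxE. Qed.

Lemma form_rdiagE m n (Z : 'M[C]_(m, n)) (d : 'I_n -> R) i :
  (Z *m rdiag_mx d *m Z^t*) i i = (\sum_k sqmod (Z i k) * d k)%:C.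
Proof.
rewrite rmorph_sum !mxE; apply: eq_bigr => k _.
by rewrite mul_mx_diag !mxE rmorphM/= sqmodE mulrAC.
Qed.

Lemma form_rdiagCE m n (Z : 'M[C]_(m, n)) (d : 'I_m -> R) k :
  (Z^t* *m rdiag_mx d *m Z) k k = (\sum_i sqmod (Z i k) * d i)%:C.
Proof.
rewrite -{2}(trmxCK Z) form_rdiagE; congr (_%:C).
by apply: eq_bigr => i _; rewrite !mxE sqmodJ.
Qed.

Lemma trmxC_mul m n p (X : 'M[C]_(m, n)) (Y : 'M[C]_(n, p)) :
  (X *m Y)^t* = Y^t* *m X^t*.
Proof. by rewrite trmx_mul map_mxM. Qed.

(** The squared singular values of [X], padded with zeros when [n > m]; [Re] loses nothing by
    [gram_spectral_diag_ge0]. *)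
Definition gram_eig m n (X : 'M[C]_(m, n)) (k : 'I_n) : R :=
  complex.Re (spectral_diag (X^t* *m X) 0 k).

Definition gram_basis m n (X : 'M[C]_(m, n)) : 'M[C]_n := spectralmx (X^t* *m X).

Lemma gram_basis_mulmxV m n (X : 'M[C]_(m, n)) :
  gram_basis X *m (gram_basis X)^t* = 1%:M.
Proof. exact/unitarymxP/spectral_unitarymx. Qed.

Lemma gram_basis_mulVmx m n (X : 'M[C]_(m, n)) :
  (gram_basis X)^t* *m gram_basis X = 1%:M.
Proof. exact/mulmx1C/gram_basis_mulmxV. Qed.

Lemma gram_spectral_diag m n (X : 'M[C]_(m, n)) :
  gram_basis X *m (X^t* *m X) *m (gram_basis X)^t* =
  diag_mx (spectral_diag (X^t* *m X)).
Proof.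
have /orthomx_spectralP : X^t* *m X \is normalmx.
  by apply/normalmxP; rewrite trmxC_mul trmxCK.
rewrite -/(gram_basis X) invmx_unitary ?spectral_unitarymx// => E.
by rewrite {1}E !mulmxA gram_basis_mulmxV mul1mx -mulmxA gram_basis_mulmxV mulmx1.
Qed.

(** In the eigenbasis, the eigenvalues are the diagonal entries of another Gram matrix, hence sums
    of squared moduli. *)
Lemma gram_spectral_diag_ge0 m n (X : 'M[C]_(m, n)) k :
  0 <= spectral_diag (X^t* *m X) 0 k.
Proof.
have /matrixP/(_ k k) := gram_spectral_diag X.
have -> : gram_basis X *m (X^t* *m X) *m (gram_basis X)^t* =
    (X *m (gram_basis X)^t*)^t* *m (X *m (gram_basis X)^t*).
  by rewrite trmxC_mul trmxCK !mulmxA.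
rewrite [RHS]mxE eqxx mulr1n => <-; rewrite mxE; apply: sumr_ge0 => i _.
by rewrite !mxE mulrC mul_conjC_ge0.
Qed.

Lemma gram_eig_ge0 m n (X : 'M[C]_(m, n)) k : 0 <= gram_eig X k.
Proof. by have := gram_spectral_diag_ge0 X k; rewrite lecE => /andP[]. Qed.

Lemma gram_diag m n (X : 'M[C]_(m, n)) :
  gram_basis X *m (X^t* *m X) *m (gram_basis X)^t* = rdiag_mx (gram_eig X).
Proof.
rewrite gram_spectral_diag; congr diag_mx; apply/rowP => k; rewrite mxE.
by rewrite RRe_real// ger0_real// gram_spectral_diag_ge0.
Qed.

Lemma gramE m n (X : 'M[C]_(m, n)) :
  X^t* *m X = (gram_basis X)^t* *m rdiag_mx (gram_eig X) *m gram_basis X.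
Proof.
rewrite -gram_diag !mulmxA gram_basis_mulVmx mul1mx -!mulmxA.
by rewrite gram_basis_mulVmx mulmx1.
Qed.

(** The eigenbasis chosen for [mxabs X] may differ from [gram_basis X]; [mxfunE] allows both
    functional calculi to be computed in the latter. *)
Lemma tr_mxfun_mxabs (f : R -> R) m n (X : 'M[C]_(m, n)) :
  \tr (mxfun f (mxabs X)) = (\sum_k f (Num.sqrt (gram_eig X k)))%:C.
Proof.
have Vu : gram_basis X \is unitarymx by exact: spectral_unitarymx.
rewrite /mxabs gramE mxfunE// mxfunE// mxtrace_mulC mulmxA.
rewrite gram_basis_mulmxV mul1mx mxtrace_diag rmorph_sum/=.
by apply: eq_bigr => k _; rewrite !mxE.
Qed.

End GramSpectrum.

(** * The inequality for one row and for one column of blocks *)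

Section BlockRowsAndColumns.
Variable R : realType.
Local Notation C := R[i].

Lemma trmxC_mxrow m q (n : 'I_q -> nat) (B : forall j, 'M[C]_(m, n j)) :
  (\mxrow_j B j)^t* = \mxcol_j (B j)^t*.
Proof. by apply/matrixP => i j; rewrite !mxE. Qed.

Lemma trmxC_mxcol m p (n : 'I_p -> nat) (B : forall i, 'M[C]_(n i, m)) :
  (\mxcol_i B i)^t* = \mxrow_i (B i)^t*.
Proof. by apply/matrixP => i j; rewrite !mxE. Qed.

Lemma gram_eig_mxrow_le (g : R -> R)
    (g_concave : concave_function (`[0, +oo[%classic : set R^o) g)
    (g0_ge0 : 0 <= g 0) m q (n : 'I_q -> nat)
    (X : forall j, 'M[C]_(m, n j)) :
  \sum_k g (gram_eig (\mxrow_j X j) k) <= \sum_j \sum_l g (gram_eig (X j) l).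
Proof.
set V := gram_basis (\mxrow_j X j); set s := gram_eig (\mxrow_j X j).
pose Y j := gram_basis (X j) *m (submxrow V j)^t*.
(* The [j]-th diagonal block of the spectral decomposition of the whole Gram matrix. *)
have Xgram j : (X j)^t* *m X j =
    (submxrow V j)^t* *m rdiag_mx s *m submxrow V j.
  have := gramE (\mxrow_j X j); rewrite -/V -/s -{1 2}(submxrowK V) !trmxC_mxrow.
  rewrite mul_mxcol_mxrow mxcol_mul.
  by rewrite mul_mxcol_mxrow => /eq_mxblockP.
have Vorth j : (submxrow V j)^t* *m submxrow V j = 1%:M.
  have := gram_basis_mulVmx (\mxrow_j X j); rewrite -/V -{1 2}(submxrowK V).
  rewrite trmxC_mxrow mul_mxcol_mxrow -mxdiagZ.
  move=> /(congr1 (submxblock^~ j ^~ j)).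
  by rewrite mxblockK submxblock_diag.
have Vsum : \sum_j submxrow V j *m (submxrow V j)^t* = 1%:M.
  rewrite -mul_mxrow_mxcol -trmxC_mxrow submxrowK; exact: gram_basis_mulmxV.
rewrite sig_big_dep/=.
pose c (l : {j : 'I_q & 'I_(n j)}) k := sqmod (Y (tag l) (tagged l) k).
apply: (substochastic_concave_le g_concave g0_ge0 (c := c)).
- by rewrite tagnat.card card_ord.
- by move=> k; exact: gram_eig_ge0.
- by move=> l k; exact: sqmod_ge0.
(* Row sums are exactly 1: [Y j] has orthonormal rows, since [V] has orthonormal columns. *)
- move=> [j l]; rewrite /c/= -lecR.
  have <- : (Y j *m rdiag_mx (fun=> 1) *m (Y j)^t*) l l =
      (\sum_k sqmod (Y j l k))%:C.
    by rewrite form_rdiagE; congr (_%:C); apply: eq_bigr => k _; rewrite mulr1.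
  rewrite rdiag_mx1 mulmx1 trmxC_mul trmxCK -mulmxA (mulmxA _ (submxrow V j)).
  by rewrite Vorth mul1mx gram_basis_mulmxV mxE eqxx.
(* Column sums are the diagonal of [\sum_j (Y j)^t* *m Y j], which reduces to [Vsum]. *)
- move=> k _; apply: complexI.
  have <- : \sum_j \sum_l sqmod (Y j l k) = \sum_l c l k by rewrite sig_big_dep.
  have /matrixP/(_ k k) := Vsum; rewrite summxE [RHS]mxE eqxx -[RHS]/(1%:C) => <-.
  rewrite rmorph_sum; apply: eq_bigr => j _ /=.
  have <- : (Y j)^t* *m rdiag_mx (fun=> 1) *m Y j =
      submxrow V j *m (submxrow V j)^t*.
    rewrite rdiag_mx1 mulmx1 trmxC_mul trmxCK -mulmxA (mulmxA _ (gram_basis _)).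
    by rewrite gram_basis_mulVmx mul1mx.
  by rewrite form_rdiagCE; congr (_%:C); apply: eq_bigr => l _; rewrite mulr1.
- move=> [j l]; rewrite /c/=; apply: complexI; rewrite -form_rdiagE.
  rewrite trmxC_mul trmxCK mulmxA -2!(mulmxA (gram_basis _)) -Xgram gram_diag.
  by rewrite !mxE eqxx.
Qed.

Lemma gram_eig_mxcol_le (g : R -> R)
    (g_concave : concave_function (`[0, +oo[%classic : set R^o) g)
    (g0_ge0 : 0 <= g 0) m p (n : 'I_p -> nat)
    (X : forall i, 'M[C]_(n i, m)) :
  (0 < p)%N ->
  \sum_k g (gram_eig (\mxcol_i X i) k) <= \sum_i \sum_l g (gram_eig (X i) l).
Proof.
move=> p_gt0; set V := gram_basis (\mxcol_i X i).
set s := gram_eig (\mxcol_i X i).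
pose Y i := gram_basis (X i) *m V^t*.
pose t i := gram_eig (X i).
(* Gram matrices of stacked blocks add up; this is that sum in the basis [V]. *)
have sE : rdiag_mx s = \sum_i (Y i)^t* *m rdiag_mx (t i) *m Y i.
  rewrite -gram_diag -/V trmxC_mxcol mul_mxrow_mxcol mulmx_sumr mulmx_suml.
  apply: eq_bigr => i _; rewrite gramE trmxC_mul trmxCK.
  by rewrite !mulmxA.
have Yunit i : Y i *m (Y i)^t* = 1%:M.
  rewrite trmxC_mul trmxCK -mulmxA (mulmxA _ V) gram_basis_mulVmx mul1mx.
  exact: gram_basis_mulmxV.
have t0 i l : 0 <= t i l by exact: gram_eig_ge0.
have sk k : s k = \sum_i \sum_l sqmod (Y i l k) * t i l.
  apply: complexI; have /matrixP/(_ k k) := sE.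
  rewrite summxE !mxE eqxx mulr1n => ->.
  by rewrite rmorph_sum; apply: eq_bigr => i _; rewrite form_rdiagCE.
have s0 k : 0 <= s k by exact: gram_eig_ge0.
have le_s i l k : sqmod (Y i l k) * t i l <= s k.
  rewrite sk (bigD1 i)//= (bigD1 l)//= -addrA lerDl addr_ge0//; last first.
    by apply: sumr_ge0 => *; apply: sumr_ge0 => *; rewrite mulr_ge0// sqmod_ge0.
  by apply: sumr_ge0 => *; rewrite mulr_ge0// sqmod_ge0.
(* Makes the quotient by [s k] in [c] harmless at [s k = 0], where division returns 0: the numerator
   vanishes too. *)
have s_eq0 i l k : s k = 0 -> sqmod (Y i l k) * t i l = 0.
  by move=> sk0; apply/eqP; rewrite eq_le -{1}sk0 le_s mulr_ge0// sqmod_ge0.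
rewrite sig_big_dep/=.
pose c (l : {i : 'I_p & 'I_m}) k :=
  sqmod (Y (tag l) (tagged l) k) * t (tag l) (tagged l) / s k.
apply: (substochastic_concave_le g_concave g0_ge0 (c := c)).
(* There are [p * m] indices against [m], whence [0 < p]. *)
- rewrite card_ord card_tagged sumnE big_map big_enum/=.
  under eq_bigr do rewrite card_ord.
  by rewrite sum_nat_const card_ord leq_pmull.
- exact: s0.
- by move=> l k; rewrite divr_ge0// mulr_ge0// sqmod_ge0.
- move=> [i l]; rewrite /c/=.
  pose a := \sum_k sqmod (Y i l k) / s k.
  have -> : \sum_k sqmod (Y i l k) * t i l / s k = a * t i l.
    by rewrite mulr_suml; apply: eq_bigr => k _; rewrite mulrAC.
  have a0 : 0 <= a by apply: sumr_ge0 => k _; rewrite divr_ge0// sqmod_ge0.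
  (* The equality case of Cauchy-Schwarz for row [l] of [Y i] in the form weighted by [s]: both the
     form at [x] and the pairing of [x] with that row equal [a]. Coordinates with [s k = 0] drop
     out, as [0^-1 = 0]. *)
  pose x : 'rV[C]_m := \row_k (Y i l k * (s k)^-1%:C).
  have xa : (x *m rdiag_mx s *m x^t*) 0 0 = a%:C.
    rewrite form_rdiagE; congr (_%:C); apply: eq_bigr => k _.
    rewrite mxE; apply: complexI; rewrite !rmorphM/= !sqmodE rmorphM/=.
    rewrite -[Num.conj _%:C]/(conjc _) conjc_real.
    have [->|sk0] := eqVneq (s k) 0; first by rewrite invr0 !mulr0.
    by rewrite mulrACA -!mulrA -!rmorphM/= mulVf// mulr1.
  have xYa : (x *m (Y i)^t*) 0 l = a%:C.
    rewrite mxE rmorph_sum; apply: eq_bigr => k _.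
    by rewrite !mxE rmorphM/= sqmodE mulrAC.
  (* Test the quadratic form of [sE] on [x]: its value is [a], and the (i, l) term
     of the right-hand side alone contributes [t i l * a ^+ 2]. *)
  have : t i l * a ^+ 2 <= a.
    rewrite -lecR -xa sE mulmx_sumr mulmx_suml summxE.
    under eq_bigr => j _.
      have -> : x *m ((Y j)^t* *m rdiag_mx (t j) *m Y j) *m x^t* =
          (x *m (Y j)^t*) *m rdiag_mx (t j) *m (x *m (Y j)^t*)^t*.
        by rewrite trmxC_mul trmxCK !mulmxA.
      rewrite form_rdiagE; over.
    rewrite -rmorph_sum lecR (bigD1 i)//= (bigD1 l)//= xYa -addrA.
    rewrite {1}/sqmod/= expr0n addr0 mulrC lerDl addr_ge0//; last first.
      by apply: sumr_ge0 => *; apply: sumr_ge0 => *; rewrite mulr_ge0// sqmod_ge0.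
    by apply: sumr_ge0 => *; rewrite mulr_ge0// sqmod_ge0.
  (* Cancelling one factor [a] bounds the row sum [a * t i l] by 1. *)
  have [->|a_neq0] := eqVneq a 0; first by rewrite mul0r.
  by rewrite expr2 mulrA -[X in _ <= X -> _]mul1r ler_pM2r ?lt0r ?a_neq0// mulrC.
- move=> k sk0; rewrite /c -mulr_suml.
  suff <- : s k = \sum_(l : {i : 'I_p & 'I_m})
      sqmod (Y (tag l) (tagged l) k) * t (tag l) (tagged l).
    by rewrite divff.
  by rewrite sk sig_big_dep.
- move=> [i l]; rewrite /c/=.
  have -> : \sum_k sqmod (Y i l k) * t i l / s k * s k =
      (\sum_k sqmod (Y i l k)) * t i l.
    rewrite mulr_suml; apply: eq_bigr => k _.
    have [sk0|sk0] := eqVneq (s k) 0; last by rewrite mulfVK.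
    by rewrite sk0 mulr0 s_eq0.
  suff -> : \sum_k sqmod (Y i l k) = 1 by rewrite mul1r.
  apply: complexI; have /matrixP/(_ l l) := Yunit i.
  rewrite -{1}(mulmx1 (Y i)) -[X in _ *m X *m _]rdiag_mx1 form_rdiagE.
  rewrite mxE eqxx -[RHS]/(1%:C).
  by move=> <-; congr (_%:C); apply: eq_bigr => k _; rewrite mulr1.
Qed.

End BlockRowsAndColumns.

Theorem theorem2p7 (R : realType) (p q : nat) (n : 'I_p -> nat) (m : 'I_q -> nat)
    (p_gt0 : (0 < p)%N) (q_gt0 : (0 < q)%N)
    (n_gt0 : forall i, (0 < n i)%N) (m_gt0 : forall j, (0 < m j)%N)
    (A : forall (i : 'I_p) (j : 'I_q), 'M[R[i]]_(n i, m j)) (f : R -> R)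
    (f_cont : {within `[0, +oo[, continuous f}) (f0_ge0 : 0 <= f 0)
    (f_sqrt_concave :
      concave_function (`[0, +oo[%classic : set R^o) (fun t : R => f (Num.sqrt t))) :
  \tr (mxfun f (mxabs (\mxblock_(i < p, j < q) A i j)))
    <= \sum_(i < p) \sum_(j < q) \tr (mxfun f (mxabs (A i j))).
Proof.
have g0_ge0 : 0 <= f (Num.sqrt 0) by rewrite sqrtr0.
(* All traces are real, so the comparison moves to [R]; summing over [j] first matches [mxblockEh],
   which reads the matrix as a row of block columns. *)
have -> : \sum_(i < p) \sum_(j < q) \tr (mxfun f (mxabs (A i j))) =
    (\sum_j \sum_i \sum_k f (Num.sqrt (gram_eig (A i j) k)))%:C.
  rewrite exchange_big rmorph_sum; apply: eq_bigr => j _.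
  by rewrite rmorph_sum; apply: eq_bigr => i _; exact: tr_mxfun_mxabs.
rewrite mxblockEh tr_mxfun_mxabs lecR.
apply: (le_trans (gram_eig_mxrow_le f_sqrt_concave g0_ge0 _)).
by apply: ler_sum => j _;
  exact: gram_eig_mxcol_le f_sqrt_concave g0_ge0 _ _ _ _ p_gt0.
Qed.
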